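(* Let $G$ be a subexponentially bounded weakly branch group acting on a $d$-regular rooted tree $T$, and let $p_1,p_2,\ldots,p_d\in(0,1)$ be pairwise distinct with $\sum_{i=1}^d p_i=1$. Let $\mu_p$ be the Bernoulli measure on $\partial T$ associated with $p=(p_1,\ldots,p_d)$. Then the action of $G$ on $(\partial T,\mu_p)$ is measure contracting.
   Context: The $d$-regular rooted tree $T$ has as its vertices the finite words over $\{1,\ldots,d\}$; the level $V_n$ is the set of words of length $n$, the root is the empty word, and each word $v$ is joined by an edge to the words $v1,\ldots,vd$. $T_v$ is the subtree emerging from $v$, i.e. the set of words having $v$ as a prefix. $\operatorname{Aut}(T)$ is the group of graph automorphisms of $T$ preserving the root. The boundary $\partial T$ is identified with the space of infinite sequences $\{1,\ldots,d\}^{\mathbb N}$, on which $\operatorname{Aut}(T)$ acts by homeomorphisms. $\mu_p=\nu_p^{\mathbb N}$, where $\nu_p$ is the probability measure on $\{1,\ldots,d\}$ with $\nu_p(\{i\})=p_i$. For $G<\operatorname{Aut}(T)$ and a vertex $v$, the rigid stabilizer $\operatorname{rist}_v(G)$ is the subgroup of elements $g\in G$ acting trivially outside of $T_v$. $G$ is called weakly branch if it is transitive on each level $V_n$ of $T$ and $\operatorname{rist}_v(G)$ is nontrivial for each vertex $v$. For $g\in\operatorname{Aut}(T)$ and a vertex $v$, the restriction $g_v\in\operatorname{Aut}(T)$ of $g$ to the subtree emerging from $v$ is defined by $g(vu)=g(v)\,g_v(u)$ for all words $u$. Let $k_n(g)$ be the number of $v\in V_n$ with $g_v\neq\mathrm{id}$.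 The element $g$ is subexponentially bounded if $\lim_{n\to\infty}k_n(g)\gamma^n=0$ for any $0<\gamma<1$. A group $G<\operatorname{Aut}(T)$ is subexponentially bounded if each $g\in G$ is. It is known that for subexponentially bounded $g$ and all $p_i>0$, the measure $\mu_p$ is quasi-invariant under $g$. Let $G$ act on a probability space $(X,\mu)$ with $\mu$ quasi-invariant. For $g\in G$, $\frac{d\mu(g(x))}{d\mu(x)}$ denotes the Radon-Nikodym derivative with respect to $\mu$ of the measure $B\mapsto\mu(gB)$, and $\operatorname{supp}(g)=\{x\in X: gx\neq x\}$. The action is called measure contracting if for every measurable subset $A\subset X$ and any $M,\epsilon>0$ there exists $g\in G$ such that 1) $\mu(\operatorname{supp}(g)\setminus A)<\epsilon$; 2) $\mu\left(\left\{x\in A:\sqrt{\tfrac{d\mu(g(x))}{d\mu(x)}}<M^{-1}\right\}\right)>\mu(A)-\epsilon$. *)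

(* Defs.v *)
From HB Require Import structures.
From mathcomp Require Import all_boot all_order all_algebra.
From mathcomp Require Import all_classical all_reals all_analysis.
From mathcomp Require Import lra.

Set Implicit Arguments.
Unset Strict Implicit.
Unset Printing Implicit Defensive.

Import Order.TTheory GRing.Theory Num.Theory.
Import numFieldTopology.Exports numFieldNormedType.Exports.

Local Open Scope classical_set_scope.
Local Open Scope ring_scope.

(* Throughout, the degree of the tree is d = k.+1 (measurable types must be
   inhabited, hence so must the alphabet); the letters are 0, ..., d - 1. *)
HB.instance Definition _ (k : nat) := isPointed.Build 'I_k.+1 ord0.

Definition word (k : nat) := seq 'I_k.+1.

Definition tree_edge k (u v : word k) : Prop :=
  exists i, v = rcons u i \/ u = rcons v i.

Definition tree_aut k (g : word k -> word k) : Prop :=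
  [/\ bijective g, g [::] = [::] &
      forall u v, tree_edge (g u) (g v) <-> tree_edge u v].

(* A subgroup of Aut(T), as a set of self-maps of the vertex set. *)
Definition aut_subgroup k (G : set (word k -> word k)) : Prop :=
  [/\ forall g, G g -> tree_aut g,
      G id,
      forall g h, G g -> G h -> G (g \o h) &
      forall g, G g -> exists2 h, G h & cancel g h /\ cancel h g].

Definition rist k (G : set (word k -> word k)) (v : word k) :
    set (word k -> word k) :=
  [set g | G g /\ forall u, ~~ prefix v u -> g u = u].

Definition weakly_branch k (G : set (word k -> word k)) : Prop :=
  (forall u v : word k, size u = size v -> exists2 g, G g & g u = v) /\
  (forall v : word k, exists2 g, rist G v g & g <> id).

(* The restriction g_v; see restrictionE for its defining equation. *)
Definition restriction k (g : word k -> word k) (v : word k) : word k -> word k :=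
  fun u => drop (size v) (g (v ++ u)).

Lemma tree_aut_rcons k (g : word k -> word k) (v : word k) i :
  tree_aut g -> exists j, g (rcons v i) = rcons (g v) j.
Proof.
case=> /bij_inj ginj g0 gadj; elim/last_ind: v i => [|v a IH] i.
  have /gadj : tree_edge (rcons [::] i) [::] by exists i; right.
  by rewrite g0 => -[j [/(congr1 size)|->]]; [rewrite size_rcons|exists j].
have /gadj : tree_edge (rcons (rcons v a) i) (rcons v a) by exists i; right.
case=> j [gva|->]; last by exists j.
have [b gvb] := IH a; move: gva; rewrite gvb => /rcons_inj[/ginj/(congr1 size)].
by rewrite !size_rcons => /eqP; rewrite (ltn_eqF (leqnSn _)).
Qed.

Lemma size_tree_aut k (g : word k -> word k) (v : word k) :
  tree_aut g -> size (g v) = size v.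
Proof.
move=> hg; elim/last_ind: v => [|v i IH]; first by have [_ ->] := hg.
by have [j ->] := tree_aut_rcons v i hg; rewrite !size_rcons IH.
Qed.

Lemma take_tree_aut k (g : word k -> word k) (v u : word k) :
  tree_aut g -> take (size v) (g (v ++ u)) = g v.
Proof.
move=> hg; elim/last_ind: u => [|u i IH].
  by rewrite cats0 -{1}(size_tree_aut v hg) take_size.
rewrite -rcons_cat; have [j ->] := tree_aut_rcons (v ++ u) i hg.
by rewrite -cats1 takel_cat// size_tree_aut// size_cat leq_addr.
Qed.

Lemma restrictionE k (g : word k -> word k) (v u : word k) :
  tree_aut g -> g (v ++ u) = g v ++ restriction g v u.
Proof. by move=> hg; rewrite -{1}(take_tree_aut v u hg) cat_take_drop. Qed.

(* k_n(g) *)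
Definition active k (g : word k -> word k) (n : nat) : nat :=
  #|[pred v : n.-tuple 'I_k.+1 | `[< restriction g v <> id >]]|.

Definition subexp_bounded (R : realType) k (g : word k -> word k) : Prop :=
  forall gamma : R, 0 < gamma < 1 ->
    (fun n => (active g n)%:R * gamma ^+ n) @ \oo --> (0 : R).

(* The sequences whose first letters spell w: the boundary of T_w. *)
Definition cylinder k (w : word k) : set (nat -> 'I_k.+1) :=
  [set x | mkseq x (size w) = w].

(* The boundary of T, with the product (= Borel) sigma-algebra. *)
Definition boundary (k : nat) := g_sigma_algebraType (range (@cylinder k)).

HB.instance Definition _ (k : nat) := Measurable.on (boundary k).

(* The n-th letter of g x is the last letter of g (x_0 ... x_n);
   see mkseq_boundary_map. *)
Definition boundary_map k (g : word k -> word k) : boundary k -> boundary k :=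
  fun x n => last (x n) (g (mkseq x n.+1)).

Lemma mkseq_boundary_map k (g : word k -> word k) (x : boundary k) n :
  tree_aut g -> mkseq (boundary_map g x) n = g (mkseq x n).
Proof.
move=> hg; elim: n => [|n IH]; first by have [_ ->] := hg.
rewrite mkseqS IH /boundary_map mkseqS.
by have [j ->] := tree_aut_rcons (mkseq x n) (x n) hg; rewrite last_rcons.
Qed.

(* mu is the infinite product of copies of the measure on the alphabet giving
   mass p i to the letter i. *)
Definition is_bernoulli (R : realType) k (p : 'I_k.+1 -> R)
    (mu : probability (boundary k) R) : Prop :=
  forall n (A : 'I_n -> set 'I_k.+1),
    mu [set x : boundary k | forall i : 'I_n, A i (x i)] =
    (\prod_(i < n) \sum_(a < k.+1 | a \in A i) p a)%:E.

Section bernoulli_exists.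
Context (R : realType) (k : nat) (p : 'I_k.+1 -> R).
Hypotheses (p_gt0 : forall i, 0 < p i) (p_sum : \sum_(i < k.+1) p i = 1).

(* Expansion of a point of [0, 1[ along the partition into consecutive
   intervals of lengths p 0, ..., p k. *)
Let c (i : 'I_k.+1) : R := \sum_(j < k.+1 | (j < i)%N) p j.
Let in_piece i (t : R) := c i <= t < c i + p i.
Let digit (t : R) : 'I_k.+1 := odflt ord0 [pick i | in_piece i t].
Let shift (t : R) : R := (t - c (digit t)) / p (digit t).
Let expansion (t : R) : boundary k := fun n => digit (iter n shift t).

Let pw (w : word k) : R := \prod_(a <- w) p a.
Let left_end := fix left_end (w : word k) : R :=
  if w is a :: w' then c a + p a * left_end w' else 0.

Let c_mono (i j : 'I_k.+1) : (i < j)%N -> c i + p i <= c j.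
Proof.
move=> ij; rewrite /c [leRHS](bigD1 i)//= addrC lerD2r.
rewrite [leRHS](bigID (fun l : 'I_k.+1 => (l < i)%N))/=.
rewrite -[leLHS]addr0 lerD//; last by apply: sumr_ge0 => l _; exact: ltW.
rewrite le_eqVlt; apply/orP; left; apply/eqP; apply: eq_bigl => l.
by case: (ltnP l i) => li; rewrite ?andbF// andbT (ltn_trans li ij)/= neq_ltn li.
Qed.

Let in_piece_inj i j t : in_piece i t -> in_piece j t -> i = j.
Proof.
move=> /andP[i1 i2] /andP[j1 j2]; apply/val_inj/eqP; rewrite eqn_leq /=.
by case: (leqP i j) => [ij|/c_mono]; case: (leqP j i) => [//|/c_mono]; lra.
Qed.

Let in_pieceP t : 0 <= t < 1 -> in_piece (digit t) t.
Proof.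
move=> /andP[t0 t1]; rewrite /digit; case: pickP => //= nop; exfalso.
have ct (n : nat) : forall i : 'I_k.+1, (i = n :> nat) -> c i + p i <= t.
  elim: n => [|n IH] i iE.
    have := nop i; rewrite /in_piece.
    have -> : c i = 0 by rewrite /c big1// => j; rewrite iE.
    by rewrite t0/= => /negbT; rewrite -leNgt.
  have nk : (n < k.+1)%N by rewrite (ltn_trans _ (ltn_ord i))// iE.
  have := nop i; rewrite /in_piece.
  have -> : c i = c (Ordinal nk) + p (Ordinal nk).
    rewrite /c (bigD1 (Ordinal nk)) ?iE//= addrC; congr (_ + _).
    apply: eq_bigl => j; rewrite ltnS -val_eqE/=.
    by rewrite [RHS]ltn_neqAle andbC.
  by rewrite (IH (Ordinal nk))//= => /negbT; rewrite -leNgt.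
have := ct k ord_max erefl.
have -> : c ord_max + p ord_max = 1.
  rewrite -p_sum [RHS](bigD1 ord_max)//= addrC; congr (_ + _).
  apply: eq_bigl => j; rewrite -val_eqE/= ltn_neqAle.
  by rewrite -[(j <= k)%N]ltnS ltn_ord andbT.
by rewrite leNgt t1.
Qed.

Let shift01 t : 0 <= t < 1 -> 0 <= shift t < 1.
Proof.
move=> /in_pieceP /andP[h1 h2].
by rewrite divr_ge0 ?subr_ge0//= ?ltW// ltr_pdivrMr// mul1r ltrBlDl.
Qed.

Let pw_gt0 w : 0 < pw w.
Proof. by rewrite /pw; apply: prodr_gt0. Qed.

Let c_ge0 i : 0 <= c i.
Proof. by apply: sumr_ge0 => j _; exact: ltW. Qed.

Let c_le1 i : c i + p i <= 1.
Proof.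
rewrite -p_sum [leRHS](bigID (fun l : 'I_k.+1 => (l < i)%N))/= lerD2l.
rewrite (bigD1 i) ?ltnn//= lerDl; apply: sumr_ge0 => j _; exact: ltW.
Qed.

Let left_end_itv w : 0 <= left_end w /\ left_end w + pw w <= 1.
Proof.
elim: w => [|a w [IH1 IH2]]; first by rewrite /pw big_nil/= add0r.
have pa := p_gt0 a; have ca := c_ge0 a; have ca1 := c_le1 a.
rewrite /pw big_cons/= -/(pw w); split; first by rewrite addr_ge0// mulr_ge0// ltW.
rewrite -addrA -mulrDr (le_trans _ ca1)// lerD2l -[leRHS]mulr1.
by rewrite ler_pM2l.
Qed.

Let expansion_cylinder w t : 0 <= t < 1 ->
  cylinder w (expansion t) <-> left_end w <= t < left_end w + pw w.
Proof.
rewrite /cylinder/=; elim: w t => [|a w IH] t t01; first by rewrite /pw big_nil add0r.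
have mk : mkseq (expansion t) (size w).+1 =
    digit t :: mkseq (expansion (shift t)) (size w).
  rewrite /mkseq/= (iotaDl 1 0) -map_comp; congr (_ :: _); apply: eq_map => n /=.
  by rewrite /expansion /= -iterS iterSr.
have pa := p_gt0 a; have [l0 l1] := left_end_itv w; have pwp := pw_gt0 w.
rewrite /= mk /pw big_cons -/(pw w); have st := shift01 t01.
have eqv b : b = digit t ->
    (left_end w <= shift t < left_end w + pw w) =
    (c b + p b * left_end w <= t < c b + p b * left_end w + p b * pw w).
  move=> ->; rewrite /shift ler_pdivlMr// ltr_pdivrMr// lerBrDl ltrBlDl.
  by rewrite [_ * p (digit t)]mulrC [(_ + _) * p (digit t)]mulrC mulrDr addrA.
split.
  by case=> dt mw; rewrite -eqv ?dt//; apply/IH => //; move: mw; rewrite -dt.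
move=> /[dup] h /andP[h1 h2].
have da : digit t = a.
  apply: in_piece_inj (in_pieceP t01) _; rewrite /in_piece.
  rewrite (le_trans _ h1) ?lerDl ?(mulr_ge0 (ltW pa) l0)//=.
  rewrite (lt_le_trans h2)// -addrA -mulrDr lerD2l -[leRHS]mulr1.
  by rewrite ler_pM2l.
by rewrite da; congr (_ :: _); apply/IH => //; rewrite (eqv a).
Qed.

Let I01 : set R := `[0, 1[%classic.
Let trunc (t : R) : R := if t \in I01 then t else 0.
Let E (t : R) : boundary k := expansion (trunc t).
Let trunc01 t : 0 <= trunc t < 1.
Proof.
rewrite /trunc; case: ifPn => [|_]; last by rewrite lexx ltr01.
by rewrite inE /I01/= in_itv.
Qed.

Let E_cylinder w : I01 `&` E @^-1` cylinder w =
  `[left_end w, left_end w + pw w[%classic.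
Proof.
have [l0 l1] := left_end_itv w; apply/seteqP; split => t /=.
  move=> [t01]; rewrite /E /trunc mem_set// => /expansion_cylinder.
  by rewrite /= in_itv/=; apply; move: t01; rewrite /I01/= in_itv.
rewrite in_itv/= => /[dup] tw /andP[h1 h2].
have t01 : I01 t by rewrite /I01/= in_itv/= (le_trans l0)//= (lt_le_trans h2).
split => //; rewrite /E /trunc mem_set//; apply/expansion_cylinder => //.
Qed.

Let mE : measurable_fun setT (E : measurableTypeR R -> boundary k).
Proof.
apply: (@measurability _ _ (measurableTypeR R) (boundary k) setT E (range (@cylinder k)) erefl).
move=> _ [_ [w _ <-] <-]; rewrite setTI.
have mI : measurable (I01 : set (measurableTypeR R)) by exact: measurable_itv.
rewrite -[X in measurable X]setTI -(setUv I01) setIUl; apply: measurableU.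
  by rewrite E_cylinder; exact: measurable_itv.
have [E0|nE0] := pselect (cylinder w (expansion 0)).
  suff -> : ~` I01 `&` E @^-1` cylinder w = ~` I01 by exact: measurableC.
  apply/seteqP; split => t /=; first by case.
  by move=> nt; split => //; rewrite /E /trunc memNset.
suff -> : ~` I01 `&` E @^-1` cylinder w = set0 by [].
apply/seteqP; split => t //= -[nt]; by rewrite /E /trunc memNset.
Qed.

Let Em : {mfun measurableTypeR R >-> boundary k} :=
  @mfun_Sub _ _ (measurableTypeR R) (boundary k) E (mem_set mE).

Let U : probability (measurableTypeR R) R := uniform_prob (@ltr01 R).
Let bern : probability (boundary k) R :=
  distribution U Em.

Let U_itv (a b : R) : 0 <= a -> a <= b -> b <= 1 ->
  U `[a, b[%classic = (b - a)%:E.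
Proof.
move=> a0 ab b1; rewrite /U /= /uniform_prob (eq_integral (cst 1%E)); last first.
  move=> x; rewrite inE/= in_itv/= => /andP[ax xb]; rewrite /uniform_pdf.
  by rewrite (le_trans a0 ax) (ltW (lt_le_trans xb b1)) subr0 invr1.
rewrite integral_cst//= mul1e lebesgue_measure_itv/= lte_fin.
by case: ltgtP ab => // ->; rewrite subrr.
Qed.

Let bern_cylinder w : bern (cylinder w) = (pw w)%:E.
Proof.
have [l0 l1] := left_end_itv w; have pwp := pw_gt0 w.
have mc : measurable (E @^-1` cylinder w : set (measurableTypeR R)).
  by rewrite -[X in measurable X]setTI; apply: mE => //; apply: sub_sigma_algebra; exists w.
have mI : measurable (I01 : set (measurableTypeR R)) by exact: measurable_itv.
rewrite /bern /= /distribution /pushforward.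
rewrite -[X in U X]setTI -(setUv I01) setIUl measureU//; last 3 first.
- exact: measurableI.
- by apply: measurableI => //; exact: measurableC.
- by rewrite setIACA setICr set0I.
rewrite E_cylinder [X in (X + _)%E](_ : _ = (pw w)%:E); last first.
  apply: etrans (U_itv l0 _ l1) _; first by rewrite lerDl ltW.
  by rewrite addrAC subrr add0r.
rewrite [X in (_ + X)%E](_ : _ = 0%E) ?adde0//.
apply/eqP; rewrite eq_le measure_ge0 andbT.
have <- : U (~` I01) = 0%E.
  by rewrite probability_setC// U_itv// subr0 subee.
by apply: le_measure; rewrite ?inE//; [apply: measurableI => //|]; exact: measurableC.
Qed.

Lemma bernoulli_exists : exists mu : probability (boundary k) R, is_bernoulli p mu.
Proof.
exists bern => n A.
pose F (f : {ffun 'I_n -> 'I_k.+1}) : set (boundary k) := cylinder (codom f).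
pose Q := [pred f : {ffun 'I_n -> 'I_k.+1} | f \in family (fun i => [pred a | a \in A i])].
have sz (f : {ffun 'I_n -> 'I_k.+1}) : size (codom f : word k) = n.
  by rewrite size_codom card_ord.
have FE (f : {ffun 'I_n -> 'I_k.+1}) x : F f x <-> forall i : 'I_n, x i = f i.
  rewrite /F /cylinder/= sz; split=> [xf i|xf].
    rewrite -(nth_mkseq (f i) x (ltn_ord i)) xf codomE.
    by rewrite (nth_map i) ?size_enum_ord// nth_ord_enum.
  apply: (@eq_from_nth _ ord0) => [|j]; rewrite size_mkseq ?sz// => jn.
  rewrite nth_mkseq// (xf (Ordinal jn)) codomE.
  rewrite (nth_map (Ordinal jn)) ?size_enum_ord//; congr (f _).
  exact/esym/(nth_ord_enum (Ordinal jn) (Ordinal jn)).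
have QP f : f \in Q <-> forall i, A i (f i).
  split => [/familyP h i|h]; first by have := h i; rewrite !inE.
  by apply/familyP => i; rewrite !inE.
have -> : [set x : boundary k | forall i : 'I_n, A i (x i)] = \bigcup_(f in [set` Q]) F f.
  apply/seteqP; split => [x /= Ax|x [f /= /QP Af /FE xf] i]; last by rewrite xf.
  exists [ffun i => x (val i)]; first by apply/QP => i; rewrite ffunE; exact: Ax.
  by apply/FE => i; rewrite ffunE.
rewrite measure_fin_bigcup//; last 2 first.
- move=> f g _ _ [x [/FE xf /FE xg]]; apply/ffunP => i.
  by rewrite -xf -xg.
- by move=> f _; apply: sub_sigma_algebra; exists (codom f).
rewrite fsbig_finite//= (perm_big (enum Q)); last first.
  apply: uniq_perm => [||f]; [exact: finmap.fset_uniq|exact: enum_uniq|].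
  by rewrite in_fset_set// mem_enum mem_setE.
rewrite big_enum/= (eq_bigr (fun f : {ffun 'I_n -> 'I_k.+1} => (pw (codom f))%:E)); last first.
  by move=> f _; exact: bern_cylinder.
rewrite sumEFin; congr (_%:E); rewrite (bigA_distr_big_dep _ (fun i a => p a)).
apply: eq_big => f //; rewrite /pw codomE big_map => _.
by rewrite big_enum.
Qed.

End bernoulli_exists.

Section measure_contracting.
Context d (X : measurableType d) (R : realType).
Variables (mu : probability X R) (H : set (X -> X)).
Local Open Scope ereal_scope.
Local Open Scope charge_scope.

Definition quasi_invariant : Prop :=
  forall g, H g -> measurable_fun setT g /\
    forall B, measurable B -> mu (g @` B) = 0 <-> mu B = 0.

(* H is the set of transformations of X given by the elements of a group. For
   h the inverse of g, [distribution mu h] is the measure B |-> mu (g B), since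
   h @^-1` B = g @` B. *)
Definition measure_contracting : Prop :=
  quasi_invariant /\
  forall A, measurable A -> forall M e : R, (0 < M)%R -> (0 < e)%R ->
  exists g h : {mfun X >-> X},
    [/\ H g, cancel g h, cancel h g,
        mu ([set x | g x <> x] `\` A) < e%:E &
        mu [set x | A x /\
          sqrte (('d (charge_of_finite_measure (distribution mu h)) '/d mu) x)
            < (M^-1)%:E] > mu A - e%:E].

End measure_contracting.

(* Main.v *)
(* For a measurable A, approximate A by a finite union of subtrees T_w, and
   multiply elements g_w of the rigid stabilizers rist_w. Everything reduces to
   making the Hellinger affinity sum_y sqrt (p y * p (g_w y)), over the words y
   of a large fixed length, arbitrarily small, since on the set where the
   Radon-Nikodym derivative is at least M^-2 the measure of T_(wy) is bounded by
   min (p (wy)) (M^2 p (g (wy))), hence by M times the geometric mean.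

   A uniform bound c < 1 on the affinity comes from looking at the first level
   on which rist_v acts nontrivially below v: by transitivity, conjugates act
   nontrivially below every vertex u of the preceding level, and a suitable
   product moves at least half of these u, measured by p. At such a u the
   letters are permuted nontrivially, and the p_i are distinct.

   The affinity is then made small by iteration: first apply elements of
   rist_(vu) for all u of some length, then g in rist_v. Below each u with
   trivial restriction of g the affinities multiply; the other u contribute at
   most k_n(g) gamma^n, where gamma bounds the p_i, and this tends to 0. *)

Require Import Defs.
From mathcomp Require Import all_boot all_order all_algebra.
From mathcomp Require Import perm.
From mathcomp Require Import all_classical all_reals all_analysis.
From mathcomp Require Import measurable_realfun lra.

Set Implicit Arguments.
Unset Strict Implicit.
Unset Printing Implicit Defensive.

Import Order.TTheory GRing.Theory Num.Theory.
Local Open Scope classical_set_scope.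
Local Open Scope ring_scope.

(** * Words, weights and Hellinger affinity *)

Section tree_automorphisms.
Context (k : nat).
Implicit Types (g h : word k -> word k) (u v w : word k).

Lemma size_restriction g v u : tree_aut g -> size (restriction g v u) = size u.
Proof. by move=> hg; rewrite size_drop size_tree_aut// size_cat addKn. Qed.

Lemma restriction_cat g v u y : tree_aut g ->
  restriction g v (u ++ y) = restriction g v u ++ restriction g (v ++ u) y.
Proof.
move=> hg; have : g v ++ restriction g v (u ++ y) =
    g v ++ (restriction g v u ++ restriction g (v ++ u) y).
  by rewrite catA -!restrictionE// catA.
by move/eqP; rewrite eqseq_cat// eqxx => /eqP.
Qed.

Lemma restriction_inj g v : tree_aut g -> injective (restriction g v).
Proof.
move=> hg x y xy; have [/bij_inj gi _ _] := hg.
have := gi (v ++ x) (v ++ y); rewrite !restrictionE// xy => /(_ erefl)/eqP.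
by rewrite eqseq_cat// eqxx => /eqP.
Qed.

Lemma restriction_comp g h v u : tree_aut g -> tree_aut h ->
  restriction (g \o h) v u = restriction g (h v) (restriction h v u).
Proof.
move=> hg hh; rewrite {1}/restriction/= (restrictionE v u hh).
by rewrite -{1}(size_tree_aut v hh).
Qed.

Definition restriction_tuple g v (hg : tree_aut g) j (y : j.-tuple 'I_k.+1) :
    j.-tuple 'I_k.+1 :=
  Tuple (introT eqP (etrans (size_restriction v y hg) (size_tuple y))).

Lemma restriction_tuple_inj g v (hg : tree_aut g) j :
  injective (@restriction_tuple g v hg j).
Proof.
move=> x y /(congr1 val)/= /(restriction_inj hg) xy; exact/val_inj.
Qed.

End tree_automorphisms.

(** The summand lives on sequences, so splitting a level needs no cast between tuple types. *)
Lemma sum_cat_tuple (V : nmodType) (T : finType) (i j : nat)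
    (F : seq T -> V) :
  \sum_(u : (i + j).-tuple T) F u =
  \sum_(u : i.-tuple T) \sum_(y : j.-tuple T) F (u ++ y).
Proof.
rewrite pair_big/= (reindex (fun x : i.-tuple T * j.-tuple T => [tuple of x.1 ++ x.2])).
  by apply: eq_bigr => -[].
have sz1 (u : (i + j).-tuple T) : size (take i u) == i.
  by rewrite size_takel// size_tuple leq_addr.
have sz2 (u : (i + j).-tuple T) : size (drop i u) == j.
  by rewrite size_drop size_tuple addKn.
exists (fun u => (Tuple (sz1 u), Tuple (sz2 u))) => [[x y] _|u _].
  by congr (_, _); apply: val_inj => /=; [apply: take_size_cat|apply: drop_size_cat];
    rewrite size_tuple.
by apply: val_inj; rewrite /= cat_take_drop.
Qed.

Lemma sum_tuple1 (V : nmodType) (T : finType) (F : seq T -> V) :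
  \sum_(u : 1.-tuple T) F u = \sum_(a : T) F [:: a].
Proof.
rewrite (reindex (fun a : T => [tuple a])) //=.
exists (fun t => thead t) => [a _|t _]; first by rewrite theadE.
by apply: val_inj; case: t => -[|? []].
Qed.

Section words_weights.
Context (R : realType) (k : nat) (p : 'I_k.+1 -> R).
Hypotheses (p_gt0 : forall i, 0 < p i) (p_sum : \sum_(i < k.+1) p i = 1).
Implicit Types (g h : word k -> word k) (u v w : word k).

Definition weight (w : word k) : R := \prod_(a <- w) p a.

Lemma weight_cat u v : weight (u ++ v) = weight u * weight v.
Proof. exact: big_cat. Qed.

Lemma weight_gt0 w : 0 < weight w.
Proof. by rewrite /weight; apply: prodr_gt0. Qed.
Hint Resolve weight_gt0 : core.

Lemma weight_ge0 w : 0 <= weight w.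
Proof. exact: ltW. Qed.
Hint Resolve weight_ge0 : core.

Lemma weight_le_exp (gamma : R) w : (forall i, p i <= gamma) ->
  weight w <= gamma ^+ size w.
Proof.
move=> pg; rewrite /weight; elim: w => [|a w IH]; first by rewrite big_nil.
by rewrite big_cons/= exprS ler_pM ?weight_ge0// ltW.
Qed.

Lemma sum_weight j : \sum_(y : j.-tuple 'I_k.+1) weight y = 1.
Proof.
elim: j => [|j IH].
  rewrite (big_pred1 [tuple]) => [|y]; first by rewrite /weight big_nil.
  exact/esym/eqP/tuple0.
rewrite -add1n (sum_cat_tuple _ _ weight) -p_sum.
rewrite (sum_tuple1 (fun u => \sum_(y : j.-tuple _) weight (u ++ y))).
apply: eq_bigr => a _.
rewrite (eq_bigr (fun y : j.-tuple _ => p a * weight y)); last first.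
  by move=> y _; rewrite weight_cat /weight big_seq1.
by rewrite -mulr_sumr IH mulr1.
Qed.

(* y ranges over the words of length j, the vertices at depth j below v. *)
Definition affinity g v j : R :=
  \sum_(y : j.-tuple 'I_k.+1) Num.sqrt (weight y * weight (restriction g v y)).

Lemma sqrt_mul_le (a b : R) : 0 <= a -> 0 <= b ->
  Num.sqrt (a * b) <= (a + b) / 2.
Proof.
move=> a0 b0; rewrite sqrtrM// -{2}(sqr_sqrtr a0) -{2}(sqr_sqrtr b0).
by have := sqr_ge0 (Num.sqrt a - Num.sqrt b); nra.
Qed.

Lemma sum_weight_restriction g v j : tree_aut g ->
  \sum_(y : j.-tuple 'I_k.+1) weight (restriction g v y) = 1.
Proof.
move=> hg; rewrite -(sum_weight j).
by rewrite [RHS](reindex_inj (@restriction_tuple_inj _ g v hg j)).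
Qed.

(** Arithmetic-geometric mean in each term; both families of weights have total mass 1. *)
Lemma affinity_le1 g v j : tree_aut g -> affinity g v j <= 1.
Proof.
move=> hg; apply: (@le_trans _ _ (\sum_(y : j.-tuple 'I_k.+1)
    (weight y + weight (restriction g v y)) / 2)).
  by apply: ler_sum => y _; exact: sqrt_mul_le.
by rewrite -mulr_suml big_split/= sum_weight sum_weight_restriction//; lra.
Qed.

(** Weights are multiplicative and restrictions obey the cocycle rule [restriction_cat]; this is
    what lets affinities at successive depths multiply. *)
Lemma affinity_cat g v i j : tree_aut g -> affinity g v (i + j) =
  \sum_(u : i.-tuple 'I_k.+1)
    Num.sqrt (weight u * weight (restriction g v u)) * affinity g (v ++ u) j.
Proof.
move=> hg; rewrite /affinity
  (sum_cat_tuple _ _ (fun y => Num.sqrt (weight y * weight (restriction g v y)))).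
apply: eq_bigr => u _; rewrite mulr_sumr; apply: eq_bigr => y _.
by rewrite restriction_cat// !weight_cat mulrACA sqrtrM// mulr_ge0.
Qed.

(** Going deeper multiplies each term by an affinity at most 1. Bounds obtained at different depths
    can thus be moved to a common one. *)
Lemma affinity_monotone g v i j : tree_aut g -> (i <= j)%N ->
  affinity g v j <= affinity g v i.
Proof.
move=> hg /subnKC <-; rewrite affinity_cat//; apply: ler_sum => u _.
by rewrite ler_piMr ?sqrtr_ge0 ?affinity_le1.
Qed.

Lemma eq_affinity g h v j : restriction g v =1 restriction h v ->
  affinity g v j = affinity h v j.
Proof. by move=> gh; apply: eq_bigr => y _; rewrite gh. Qed.

End words_weights.

(** * Rigid stabilizers *)

Section rigid_stabilizers.
Context (k : nat) (G : set (word k -> word k)).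
Hypothesis hG : aut_subgroup G.
Implicit Types (g h : word k -> word k) (u v w : word k).

Lemma aut_subgroup_aut g : G g -> tree_aut g.
Proof. by have [+ _ _ _] := hG; exact. Qed.

Lemma aut_subgroup_comp g h : G g -> G h -> G (g \o h).
Proof. by have [_ _ + _] := hG; exact. Qed.

Lemma rist_id v : rist G v id.
Proof. by have [_ ? _ _] := hG; split. Qed.

Lemma rist_comp v g h : rist G v g -> rist G v h -> rist G v (g \o h).
Proof.
move=> [Gg gv] [Gh hv]; split => [|u uv /=]; first exact: aut_subgroup_comp.
by rewrite hv// gv.
Qed.

(** If [g v] differed from [v], it would be a word of the same length without prefix [v], so [g]
    would fix [g v]; injectivity then gives [g v = v]. *)
Lemma rist_fix v g : rist G v g -> g v = v.
Proof.
move=> [Gg gv]; have ga := aut_subgroup_aut Gg; have [/bij_inj gi _ _] := ga.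
case: (eqVneq (g v) v) => // gvv; apply: gi; apply: gv.
by rewrite prefixE -(size_tree_aut v ga) take_size.
Qed.

(** Since [h] fixes [v], it preserves the subtree at [v], so [h'] sends words outside it to words
    outside it, where [g] is trivial. *)
Lemma rist_conj v g h h' : G h -> G h' -> cancel h h' -> cancel h' h ->
  h v = v -> rist G v g -> rist G v (h \o g \o h').
Proof.
move=> Gh Gh' hK h'K hv [Gg gv]; split => [|u uv /=].
  exact: aut_subgroup_comp (aut_subgroup_comp Gh Gg) Gh'.
rewrite gv ?h'K//; apply: contra uv; rewrite !prefixE => /eqP vu.
have := take_tree_aut (take (size v) (h' u)) (drop (size v) (h' u))
  (aut_subgroup_aut Gh).
by rewrite cat_take_drop h'K vu hv => ->.
Qed.

Lemma take_rist v g u : rist G v g -> take (size v) u = v ->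
  take (size v) (g u) = v.
Proof.
move=> gv uv; have [/aut_subgroup_aut ga _] := gv.
by rewrite -[u in g u](cat_take_drop (size v)) uv take_tree_aut// rist_fix.
Qed.

(** The product of the [F w]: distinct words of the same length carry disjoint subtrees, so each
    word is moved by at most one factor. *)
Lemma rist_glue n (F : word k -> word k -> word k) (s : seq (word k)) :
  (forall w, w \in s -> size w = n) -> (forall w, w \in s -> rist G w (F w)) ->
  exists2 g, G g &
    forall u, g u = if take n u \in s then F (take n u) u else u.
Proof.
elim: s => [|w s IH] szs Fs; first by exists id; have [_ ? _ _] := hG.
have /IH[|g Gg gE] : forall w, w \in s -> size w = n.
- by move=> x xs; apply: szs; rewrite in_cons xs orbT.
- by move=> x xs; apply: Fs; rewrite in_cons xs orbT.
(* A repeated word must contribute its factor only once. *)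
case: (boolP (w \in s)) => ws.
  by exists g => // u; rewrite in_cons gE; case: eqP => // ->; rewrite ws.
have Fw := Fs w (mem_head _ _); have szw := szs w (mem_head _ _).
exists (F w \o g) => [|u /=].
  by apply: aut_subgroup_comp => //; case: Fw.
rewrite gE in_cons; case: (eqVneq (take n u) w) => /= [->|uw].
  by rewrite (negbTE ws).
(* In both cases the word reached by [g] lies outside the subtree of [w]: its prefix of length [n]
   is still [take n u], since a rigid stabilizer preserves its own subtree. *)
case: ifP => us; apply: (proj2 Fw); rewrite prefixE szw; last exact: uw.
have szu := szs _ (mem_behead (us : take n u \in behead (w :: s))).
by have := take_rist (Fs _ (mem_behead (us : _ \in behead (w :: s)))) (u := u);
  rewrite szu => ->.
Qed.

Hypothesis hwb : weakly_branch G.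

(** [l.+1] is the least depth below [v] at which the rigid stabilizer moves a word; it exists
    because that stabilizer is nontrivial. *)
Lemma rist_first_move v : exists l,
  (forall g u, rist G v g -> (size u <= l)%N -> g (v ++ u) = v ++ u) /\
  (exists g u i, [/\ rist G v g, size u = l &
     g (v ++ rcons u i) <> v ++ rcons u i]).
Proof.
pose P n := `[< exists g u, [/\ rist G v g, size u = n & g (v ++ u) <> v ++ u] >].
have [g gv gid] := hwb.2 v.
have exP : exists n, P n.
  have [x gx] : exists x, g x <> x.
    apply: contra_notP gid => /forallNP gx; apply/funext => x.
    exact: (contrapT (gx x)).
  have : prefix v x by apply: contra_notT gx; exact: gv.2.
  move=> /prefixP[u xE]; exists (size u); apply/asboolP; exists g, u.
  by rewrite -xE.
case: (ex_minnP exP) => -[|l] /asboolP[g0 [u [g0v szu g0u]]] lmin.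
  (* Depth 0 is impossible, as the rigid stabilizer fixes [v]. *)
  by move: g0u; rewrite (size0nil szu) cats0 rist_fix.
exists l; split => [h u' hv szu'|].
  apply: contrapT => hu; have /lmin : P (size u') by apply/asboolP; exists h, u'.
  by rewrite ltnNge szu'.
case/lastP: u szu g0u => // u i; rewrite size_rcons => -[szu] g0u.
by exists g0, u, i.
Qed.

Definition fixes_children g w : bool :=
  [forall i, restriction g w [:: i] == [:: i]].

(** Level transitivity gives [h] carrying [v ++ u] to [v ++ u']. Such an [h] fixes [v]
    automatically, so conjugation by it preserves the rigid stabilizer and transports the moved
    child. *)
Lemma rist_move_children v : exists l,
  (forall g u, rist G v g -> (size u <= l)%N -> g (v ++ u) = v ++ u) /\
  (forall u, size u = l -> exists2 g, rist G v g & ~~ fixes_children g (v ++ u)).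
Proof.
have [l [lfix [g [u [i [gv szu gu]]]]]] := rist_first_move v.
exists l; split=> // u' szu'.
have [h Gh hu] : exists2 h, G h & h (v ++ u) = v ++ u'.
  by apply: hwb.1; rewrite !size_cat szu szu'.
have ha := aut_subgroup_aut Gh; have [_ _ _ /(_ _ Gh)[h' Gh' [hK h'K]]] := hG.
have hv : h v = v by rewrite -(take_tree_aut v u ha) hu take_size_cat.
have hgv := rist_conj Gh Gh' hK h'K hv gv.
exists (h \o g \o h') => //; apply/forallPn.
have [j hj] := tree_aut_rcons (v ++ u) i ha.
exists j; apply/eqP => E; apply: gu; apply: (can_inj hK).
have hga := aut_subgroup_aut hgv.1.
have := restrictionE (v ++ u') [:: j] hga; rewrite E (lfix _ _ hgv) ?szu'//=.
by rewrite -hu !cats1 -hj hK rcons_cat.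
Qed.

End rigid_stabilizers.

Section letters.
Context (k : nat).
Implicit Types (g h : word k -> word k) (u v w : word k).

(** The default of [head] is never reached for a tree automorphism, whose restrictions preserve
    length. *)
Definition child_map g w (a : 'I_k.+1) : 'I_k.+1 := head a (restriction g w [:: a]).

Lemma restriction1 g w a : tree_aut g ->
  restriction g w [:: a] = [:: child_map g w a].
Proof.
move=> hg; rewrite /child_map; have := size_restriction w [:: a] hg.
by case: (restriction g w [:: a]) => [|b []].
Qed.

Lemma child_map_inj g w : tree_aut g -> injective (child_map g w).
Proof.
move=> hg a b ab; have : restriction g w [:: a] = restriction g w [:: b].
  by rewrite !restriction1// ab.
by move=> /(restriction_inj hg)[].
Qed.

Lemma fixes_childrenE g w : tree_aut g ->
  fixes_children g w = [forall i, child_map g w i == i].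
Proof. by move=> hg; apply: eq_forallb => i; rewrite restriction1// eqseq_cons andbT. Qed.

Lemma child_map_comp g h w a : tree_aut g -> tree_aut h -> h w = w ->
  child_map (g \o h) w a = child_map g w (child_map h w a).
Proof.
move=> hg hh hw; rewrite /child_map restriction_comp// hw (restriction1 w a hh)/=.
by rewrite !restriction1.
Qed.

End letters.

(** * A uniform affinity bound below 1 *)

Section gap.
Context (R : realType) (k : nat) (p : 'I_k.+1 -> R).
Hypotheses (p_gt0 : forall i, 0 < p i) (p_sum : \sum_(i < k.+1) p i = 1).
Hypothesis p_inj : injective p.
Context (G : set (word k -> word k)).
Hypotheses (hG : aut_subgroup G) (hwb : weakly_branch G).
Implicit Types (g h : word k -> word k) (u v w : word k).

(** An arbitrary [D] makes induction on its cardinality possible: some [h] moves children at a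
    nonempty part [E] of [D], the inductive [g] handles the rest, and one of [g] and [h \o g]
    handles both. *)
Lemma rist_move_half v l (D : {set l.-tuple 'I_k.+1}) :
  (forall g u, rist G v g -> (size u <= l)%N -> g (v ++ u) = v ++ u) ->
  (forall u, size u = l -> exists2 g, rist G v g & ~~ fixes_children g (v ++ u)) ->
  exists2 g, rist G v g &
    \sum_(s in D | fixes_children g (v ++ s)) weight p s <=
    (\sum_(s in D) weight p s) / 2.
Proof.
move=> lfix lmove; have [n] := ubnP #|D|; elim: n D => // n IH D.
rewrite ltnS => Dn; have [->|[s sD]] := set_0Vmem D.
  exists id; first exact: rist_id.
  by rewrite !big1 ?mul0r// => s; rewrite inE.
have [h hv hs] := lmove s (size_tuple s).
(* Where h moves children, at most one of g and h \o g fixes them all; where it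
   does not, g and h \o g agree on children. *)
pose D' := [set t in D | fixes_children h (v ++ t)].
have [|g gv gD'] := IH D'.
  rewrite (leq_trans _ Dn)//; apply/proper_card/properP; split.
    by apply/fintype.subsetP => t; rewrite inE => /andP[].
  by exists s => //; rewrite inE (negbTE hs) andbF.
have ha := aut_subgroup_aut hG hv.1; have ga := aut_subgroup_aut hG gv.1.
have hga := aut_subgroup_aut hG (rist_comp hG hv gv).1.
have gfix (t : l.-tuple 'I_k.+1) : g (v ++ t) = v ++ t.
  by rewrite lfix// size_tuple.
have hg_fix (t : l.-tuple 'I_k.+1) : fixes_children h (v ++ t) ->
    fixes_children (h \o g) (v ++ t) = fixes_children g (v ++ t).
  rewrite !fixes_childrenE// => /forallP ht; apply: eq_forallb => i.
  by rewrite child_map_comp// (eqP (ht _)).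
have hg_nfix (t : l.-tuple 'I_k.+1) : ~~ fixes_children h (v ++ t) ->
    fixes_children g (v ++ t) -> ~~ fixes_children (h \o g) (v ++ t).
  rewrite !fixes_childrenE// => + /forallP gt; apply: contra => /forallP hgt.
  by apply/forallP => i; rewrite -{2}(eqP (hgt i)) child_map_comp// (eqP (gt i)).
pose E := [pred t | (t \in D) && ~~ fixes_children h (v ++ t)].
have split_sum f : \sum_(t in D | fixes_children f (v ++ t)) weight p t =
    \sum_(t in D' | fixes_children f (v ++ t)) weight p t +
    \sum_(t in E | fixes_children f (v ++ t)) weight p t.
  rewrite (bigID (fun t : l.-tuple _ => fixes_children h (v ++ t)))/=.
  by congr (_ + _); apply: eq_bigl => t; rewrite !inE andbAC.
have split_D : \sum_(t in D) weight p t =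
    \sum_(t in D') weight p t + \sum_(t in E) weight p t.
  rewrite (bigID (fun t : l.-tuple _ => fixes_children h (v ++ t)))/=.
  by congr (_ + _); apply: eq_bigl => t; rewrite !inE.
have D'_hg : \sum_(t in D' | fixes_children (h \o g) (v ++ t)) weight p t =
    \sum_(t in D' | fixes_children g (v ++ t)) weight p t.
  apply: eq_bigl => t; rewrite inE; case: (boolP (fixes_children h _)) => [ht|].
    by rewrite hg_fix.
  by rewrite andbF.
have E_hg : \sum_(t in E | fixes_children g (v ++ t)) weight p t +
    \sum_(t in E | fixes_children (h \o g) (v ++ t)) weight p t <=
    \sum_(t in E) weight p t.
  rewrite [leRHS](bigID (fun t : l.-tuple _ => fixes_children g (v ++ t)))/= lerD2l.
  rewrite [leLHS]big_mkcondr [leRHS]big_mkcondr; apply: ler_sum => t.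
  rewrite inE => /andP[_ ht]; have := hg_nfix t ht.
  case: (fixes_children g _) => [/(_ isT)/negbTE->//|_ /=].
  by case: ifP => // _; exact: weight_ge0.
(* If [g] fixes the children on more than half of the weight of [E], then [h \o g] does so on less
   than half; on [D'] the two sums agree. *)
case: (leP (\sum_(t in E | fixes_children g (v ++ t)) weight p t)
    ((\sum_(t in E) weight p t) / 2)) => Eg.
  exists g => //; rewrite split_sum split_D; lra.
exists (h \o g); first exact: rist_comp.
rewrite split_sum split_D D'_hg; lra.
Qed.

Lemma sqrt_mul_lt (a b : R) : 0 < a -> 0 < b -> a != b ->
  Num.sqrt (a * b) < (a + b) / 2.
Proof.
move=> a0 b0 ab; rewrite sqrtrM ?ltW//.
have : Num.sqrt a - Num.sqrt b != 0.
  by rewrite subr_eq0 eqr_sqrt ?ltW.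
rewrite -sqrf_eq0 => sab; have := sqr_ge0 (Num.sqrt a - Num.sqrt b).
rewrite le_eqVlt eq_sym (negbTE sab)/= => {}sab.
rewrite -{2}(sqr_sqrtr (ltW a0)) -{2}(sqr_sqrtr (ltW b0)); nra.
Qed.

(** The mean inequality is strict at a moved letter, where [p] takes two distinct values. *)
Lemma perm_affinity_lt1 (s : {perm 'I_k.+1}) : [exists a, s a != a] ->
  \sum_a Num.sqrt (p a * p (s a)) < 1.
Proof.
move=> /existsP[a sa].
apply: (@lt_le_trans _ _ (\sum_a (p a + p (s a)) / 2)).
  rewrite (bigD1 a)//= [ltRHS](bigD1 a)//=; apply: ltr_leD.
    by apply: sqrt_mul_lt => //; rewrite (inj_eq p_inj) eq_sym.
  by apply: ler_sum => b _; apply: sqrt_mul_le; exact: ltW.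
rewrite -mulr_suml big_split/= p_sum.
suff -> : \sum_a p (s a) = 1 by lra.
by rewrite -p_sum [RHS](reindex_inj (@perm_inj _ s)).
Qed.

(** There are finitely many nontrivial permutations of the letters, so the largest of their
    affinities is still below 1. The initial value 0 covers the one-letter alphabet, which has
    none. *)
Lemma affinity1_gap : exists2 c0 : R, 0 <= c0 < 1 &
  forall g w, tree_aut g -> ~~ fixes_children g w -> affinity p g w 1 <= c0.
Proof.
exists (\big[Num.max/0]_(s : {perm 'I_k.+1} | [exists a, s a != a])
    \sum_a Num.sqrt (p a * p (s a))).
  rewrite bigmax_ge_id/=; apply/bigmax_ltP; split => // s; exact: perm_affinity_lt1.
move=> g w ga; rewrite fixes_childrenE// => /forallPn[i gi].
pose s := perm (child_map_inj ga (w := w)).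
apply: le_trans (@le_bigmax_cond _ _ _ _ s _ _ _).
  rewrite /affinity (sum_tuple1 (fun y => Num.sqrt (weight p y * weight p (restriction g w y)))).
  apply: ler_sum => a _.
  by rewrite restriction1// /weight !big_seq1 permE.
by apply/existsP; exists i; rewrite permE.
Qed.

Lemma rist_affinity_gap : exists2 c : R, 0 <= c < 1 &
  forall v, exists g j, rist G v g /\ affinity p g v j <= c.
Proof.
have [c0 /andP[c00 c01] c0P] := affinity1_gap.
(* At least half of the weight at depth [l] gets a factor at most [c0], the rest a factor at most 1:
   in total at most [1 / 2 + c0 / 2]. *)
exists ((1 + c0) / 2) => [|v]; first by lra.
have [l [lfix lmove]] := rist_move_children hG hwb v.
have [g gv gl] := rist_move_half [set: l.-tuple 'I_k.+1]%SET lfix lmove.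
have ga := aut_subgroup_aut hG gv.1.
exists g, (l + 1)%N; split => //; rewrite affinity_cat//.
move: gl; set tau := (X in X <= _) => tau_le.
have {}tau_le : tau <= 1 / 2.
  by apply: le_trans tau_le _; rewrite (eq_bigl xpredT) ?sum_weight// => s; rewrite inE.
pose nt : R := \sum_(s : l.-tuple 'I_k.+1 | ~~ fixes_children g (v ++ s)) weight p s.
have tau_nt : tau + nt = 1.
  rewrite -(sum_weight p_sum l) [RHS](bigID (fun s : l.-tuple _ => fixes_children g (v ++ s)))/=.
  by congr (_ + _); apply: eq_bigl => s; rewrite inE.
apply: (@le_trans _ _ (tau + nt * c0)); last by nra.
rewrite (bigID (fun s : l.-tuple _ => fixes_children g (v ++ s)))/=.
have gfix (s : l.-tuple 'I_k.+1) :
    Num.sqrt (weight p s * weight p (restriction g v s)) = weight p s.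
  rewrite /restriction lfix ?size_tuple// drop_size_cat// -expr2 sqrtr_sqr.
  by rewrite ger0_norm// weight_ge0.
rewrite lerD//.
  have -> : tau = \sum_(s : l.-tuple 'I_k.+1 | fixes_children g (v ++ s)) weight p s.
    by apply: eq_bigl => s; rewrite inE.
  by apply: ler_sum => s _; rewrite gfix ler_piMr ?weight_ge0 ?affinity_le1.
rewrite /nt mulr_suml; apply: ler_sum => s sn.
by rewrite gfix ler_wpM2l ?weight_ge0 ?c0P.
Qed.

End gap.

(** * Iteration to arbitrarily small affinity *)

Section contraction.
Context (R : realType) (k : nat) (p : 'I_k.+1 -> R).
Hypotheses (p01 : forall i, 0 < p i < 1) (p_sum : \sum_(i < k.+1) p i = 1).
Hypothesis p_inj : injective p.
Context (G : set (word k -> word k)).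
Hypotheses (hG : aut_subgroup G) (hwb : weakly_branch G).
Hypothesis hsub : forall g, G g -> subexp_bounded R g.
Implicit Types (g h : word k -> word k) (u v w : word k).

Let p_gt0 i : 0 < p i. Proof. by case/andP: (p01 i). Qed.

(** Prepending [v] injects the words of length [j] into level [size v + j], where [active]
    counts. *)
Lemma sum_active_le g v j (f : word k -> R) (B : R) : 0 <= B ->
  (forall u : j.-tuple 'I_k.+1, f u <= B) ->
  \sum_(u : j.-tuple 'I_k.+1 | `[< restriction g (v ++ u) <> id >]) f u <=
  (active g (size v + j))%:R * B.
Proof.
move=> B0 fB; apply: (@le_trans _ _ (\sum_(u : j.-tuple 'I_k.+1 |
    `[< restriction g (v ++ u) <> id >]) B)); first exact: ler_sum.
rewrite sumr_const -[leLHS]mulr_natl ler_wpM2r// ler_nat.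
pose cat_v (u : j.-tuple 'I_k.+1) : (size v + j).-tuple 'I_k.+1 :=
  [tuple of in_tuple v ++ u].
have cat_inj : injective cat_v.
  move=> x y /(congr1 val)/= /eqP; rewrite eqseq_cat// eqxx => /eqP xy.
  exact/val_inj.
rewrite -(fintype.card_image cat_inj); apply/subset_leq_card/fintype.subsetP => x.
by move=> /fintype.imageP[u hu ->].
Qed.

Lemma letter_bound : exists2 gamma : R, 0 < gamma < 1 & forall i, p i <= gamma.
Proof.
exists (\big[Num.max/p ord0]_i p i) => [|i]; last exact: le_bigmax.
rewrite (lt_le_trans (p_gt0 ord0)) ?bigmax_ge_id//=.
have /andP[_ p01'] := p01 ord0.
by apply/bigmax_ltP; split => // i _; have /andP[] := p01 i.
Qed.

(** The fixed factor [gamma ^+ m] between level [m + j] and depth [j] is absorbed by asking for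
    [eta * gamma ^+ m] in the limit. *)
Lemma active_small g (m : nat) (gamma eta : R) : subexp_bounded R g ->
  0 < gamma < 1 -> 0 < eta -> exists j0, forall j, (j0 <= j)%N ->
  (active g (m + j))%:R * gamma ^+ j <= eta.
Proof.
move=> gsub gamma01 eta0; have /andP[g0 g1] := gamma01.
have gm0 : 0 < gamma ^+ m by rewrite exprn_gt0.
have /cvgr0_norm_lt/(_ (eta * gamma ^+ m))[|N _ NP] := gsub _ gamma01.
  by rewrite mulr_gt0.
exists N => j Nj; have := NP (m + j)%N (leq_trans Nj (leq_addl _ _)).
rewrite /= ger0_norm; last by rewrite mulr_ge0// exprn_ge0// ltW.
by rewrite exprD mulrCA [leLHS]mulrC [ltRHS]mulrC ltr_pM2l// mulrC => /ltW.
Qed.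

(** The element is [g0 \o g1], with [g1] glued from the [F (v ++ u)]. Since [g1] fixes every
    [v ++ u], these words are moved by [g0] alone, and below one where [g0] has trivial restriction
    only [F] remains. *)
Lemma rist_glue_affinity v j (F : word k -> word k -> word k) g0 :
  rist G v g0 -> (forall w, rist G w (F w)) ->
  exists g, rist G v g /\ forall (u : j.-tuple 'I_k.+1),
    g (v ++ u) = g0 (v ++ u) /\
    (restriction g0 (v ++ u) = id ->
     restriction g (v ++ u) =1 restriction (F (v ++ u)) (v ++ u)).
Proof.
move=> gv0 FP.
pose s := [seq v ++ val x | x <- enum {: j.-tuple 'I_k.+1}].
have szs w : w \in s -> size w = (size v + j)%N.
  by move=> /mapP[u _ ->]; rewrite size_cat size_tuple.
have [g1 Gg1 g1E] := rist_glue hG szs (fun w _ => FP w).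
have us (u : j.-tuple 'I_k.+1) : v ++ u \in s.
  by apply/mapP; exists u; rewrite ?mem_enum.
have g1u (u : j.-tuple 'I_k.+1) y : g1 (v ++ u ++ y) = F (v ++ u) (v ++ u ++ y).
  have szu : (size v + j)%N = size (v ++ u) by rewrite size_cat size_tuple.
  by rewrite g1E catA szu take_size_cat// us.
have g1v : rist G v g1.
  split => // x vx; rewrite g1E; case: ifP => // /mapP[u _ tx].
  by case/negP: vx; rewrite -(cat_take_drop (size v + j) x) tx -catA prefix_prefix.
have g1f (u : j.-tuple 'I_k.+1) : g1 (v ++ u) = v ++ u.
  by have := g1u u [::]; rewrite cats0 => ->; rewrite (rist_fix hG (FP _)).
exists (g0 \o g1); split => [|u]; first exact: rist_comp.
split; first by rewrite /= g1f.
move=> g0u y; rewrite restriction_comp; last 2 first.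
- exact: (aut_subgroup_aut hG gv0.1).
- exact: (aut_subgroup_aut hG Gg1).
by rewrite g1f g0u /restriction -catA g1u catA.
Qed.

Lemma affinity_step (c t : R) : 0 <= c < 1 -> 0 < t ->
  (forall v, exists g j, rist G v g /\ affinity p g v j <= c) ->
  (forall v, exists g j, rist G v g /\ affinity p g v j <= t) ->
  forall v, exists g j, rist G v g /\ affinity p g v j <= t * ((1 + c) / 2).
Proof.
move=> /andP[c0 c1] t0 cP tP v.
have [gamma gamma01 pgamma] := letter_bound.
have [g0 [j0 [gv0 g0c]]] := cP v; have g0a := aut_subgroup_aut hG gv0.1.
(* The target is the sum of [t * c], for the vertices where [g0] has trivial restriction, and
   [t * ((1 - c) / 2)], for the others. *)
have eta0 : 0 < t * ((1 - c) / 2) by rewrite mulr_gt0//; lra.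
have [j1 j1P] := active_small (size v) (hsub gv0.1) gamma01 eta0.
(* Deep enough both for the affinity of [g0] to be at most [c] and for its active vertices to
   contribute little. *)
pose j := maxn j0 j1.
have {}g0c : affinity p g0 v j <= c.
  by apply: le_trans g0c; apply: affinity_monotone; rewrite ?leq_maxl.
have bad_small := j1P j (leq_maxr _ _).
have /choice[F FP] : forall w, exists f, rist G w f /\ exists i, affinity p f w i <= t.
  by move=> w; have [f [i [fw fi]]] := tP w; exists f; split => //; exists i.
have /choice[I IP] : forall w, exists i, affinity p (F w) w i <= t.
  by move=> w; have [_] := FP w.
have [g [gv gP]] := rist_glue_affinity j gv0 (fun w => (FP w).1).
have ga := aut_subgroup_aut hG gv.1.
pose i := \max_(u : j.-tuple 'I_k.+1) I (v ++ u).
exists g, (j + i)%N; split => //; rewrite affinity_cat//.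
pose a (u : word k) := Num.sqrt (weight p u * weight p (restriction g0 v u)).
have a0 u : 0 <= a u by rewrite sqrtr_ge0.
have aE (u : j.-tuple 'I_k.+1) :
    Num.sqrt (weight p u * weight p (restriction g v u)) = a u.
  by rewrite /a /restriction (gP u).1.
have good (u : j.-tuple 'I_k.+1) : restriction g0 (v ++ u) = id ->
    affinity p g (v ++ u) i <= t.
  move=> /(gP u).2/eq_affinity ->; apply: le_trans (IP (v ++ u)).
  apply: affinity_monotone => //; first exact: (aut_subgroup_aut hG (FP _).1.1).
  exact: (leq_bigmax (F := fun x : j.-tuple 'I_k.+1 => I (v ++ x)) u).
pose bad := [pred u : j.-tuple 'I_k.+1 | `[< restriction g0 (v ++ u) <> id >]].
(* At bad vertices the affinity below is only bounded by 1; at the others it is at most [t], and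
   their sum is then enlarged to the whole level. *)
apply: (@le_trans _ _ (\sum_(u | bad u) a u + t * \sum_(u : j.-tuple 'I_k.+1) a u)).
  rewrite mulr_sumr (bigID bad)/= [X in _ <= _ + X](bigID bad)/= addrA lerD//.
    rewrite -[leLHS]addr0 lerD//; last by apply: sumr_ge0 => u _; rewrite mulr_ge0// ltW.
    by apply: ler_sum => u _; rewrite aE ler_piMr// affinity_le1.
  apply: ler_sum => u /asboolPn/contrapT/good gu.
  by rewrite aE mulrC; apply: ler_wpM2r.
have -> : t * ((1 + c) / 2) = t * ((1 - c) / 2) + t * c by lra.
apply: lerD; last by rewrite ler_pM2l.
apply: le_trans bad_small; apply: sum_active_le => [|u].
  by rewrite exprn_ge0// ltW//; case/andP: gamma01.
have wle w : size w = j -> weight p w <= gamma ^+ j.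
  by move=> <-; exact: weight_le_exp.
have := wle u (size_tuple u); have := wle (restriction g0 v u).
rewrite size_restriction// size_tuple => /(_ erefl) h1 h2.
by apply: le_trans (sqrt_mul_le _ _) _; rewrite ?weight_ge0//; lra.
Qed.

(** The identity starts with affinity at most 1, and every use of [affinity_step] gains the same
    factor [(1 + c) / 2 < 1]. *)
Lemma rist_affinity_small (t : R) : 0 < t ->
  forall v, exists g j, rist G v g /\ affinity p g v j <= t.
Proof.
move=> t0; have [c c01 cP] := rist_affinity_gap p_gt0 p_sum p_inj hG hwb.
have /andP[c0 c1] := c01; pose r := (1 + c) / 2.
have r01 : 0 < r < 1 by rewrite /r; lra.
have rP n : forall v, exists g j, rist G v g /\ affinity p g v j <= r ^+ n.
  elim: n => [v|n IH].
    exists id, 0%N; split; first exact: rist_id.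
    by apply: affinity_le1 => //; have [a i _ _] := hG; exact: a.
  rewrite exprSr; apply: affinity_step => //.
  by rewrite exprn_gt0//; case/andP: r01.
have : `|r| < 1 by rewrite ger0_norm; case/andP: r01 => // /ltW.
move=> /cvg_expr/cvgr0_norm_lt/(_ t t0)[N _ NP].
move=> v; have [g [j [gv gj]]] := rP N v; exists g, j; split => //.
apply: le_trans gj (ltW (le_lt_trans (ler_norm _) _)).
by apply: NP => /=.
Qed.

End contraction.

(** * The action on the boundary *)

Section boundary_maps.
Context (k : nat).
Implicit Types (g h : word k -> word k) (u v w : word k) (x : boundary k).

Lemma measurable_cylinder w : measurable (cylinder w : set (boundary k)).
Proof. by apply: sub_sigma_algebra; exists w. Qed.

Lemma boundary_eqP (x y : boundary k) :
  (forall n, mkseq x n = mkseq y n) -> x = y.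
Proof.
move=> xy; apply/funext => n; have := congr1 (nth ord0 ^~ n) (xy n.+1).
by rewrite /= !nth_mkseq.
Qed.

Lemma boundary_map_id : boundary_map id = id :> (boundary k -> boundary k).
Proof. by apply/funext => x; apply/funext => n; rewrite /boundary_map mkseqS last_rcons. Qed.

Lemma boundary_map_comp g h : tree_aut g -> tree_aut h ->
  boundary_map (g \o h) = boundary_map g \o boundary_map h.
Proof.
move=> hg hh; have hgh : tree_aut (g \o h).
  have [gb g0 gadj] := hg; have [hb h0 hadj] := hh; split.
  - exact: bij_comp.
  - by rewrite /= h0.
  - by move=> u v; apply: iff_trans (gadj _ _) (hadj _ _).
by apply/funext => x; apply: boundary_eqP => n /=; rewrite !mkseq_boundary_map.
Qed.

Lemma boundary_mapK g h : tree_aut g -> tree_aut h -> cancel g h ->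
  cancel (boundary_map g) (boundary_map h).
Proof.
move=> hg hh gK x; have : h \o g = id by apply/funext => u /=; rewrite gK.
by move=> /(congr1 (@boundary_map k)); rewrite boundary_map_comp// boundary_map_id => /funeqP/(_ x).
Qed.

Lemma preimage_boundary_map g w : tree_aut g ->
  boundary_map g @^-1` cylinder (g w) = cylinder w.
Proof.
move=> hg; have [/bij_inj gi _ _] := hg; rewrite /cylinder.
apply/seteqP; split => x /=; rewrite size_tree_aut// mkseq_boundary_map//.
  by move=> /gi.
by move=> ->.
Qed.

Lemma measurable_boundary_map g : tree_aut g ->
  measurable_fun setT (boundary_map g : boundary k -> boundary k).
Proof.
move=> hg; have [[h gK hK] _ _] := hg.
apply: (@measurability _ _ (boundary k) (boundary k) setT _ (range (@cylinder k)) erefl).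
move=> _ [_ [w _ <-] <-]; rewrite setTI -(hK w) preimage_boundary_map//.
exact: measurable_cylinder.
Qed.

Lemma cylinder_disjoint u v x : size u = size v ->
  cylinder u x -> cylinder v x -> u = v.
Proof. by rewrite /cylinder/= => -> -> ->. Qed.

Lemma cylinder_prefix u v x : cylinder u x -> prefix v u -> cylinder v x.
Proof.
rewrite /cylinder/= => <-; rewrite prefixE => /eqP <-.
case: (leqP (size v) (size u)) => vu; last by rewrite take_oversize ?size_mkseq// ltnW.
rewrite size_takel ?size_mkseq//; apply: (@eq_from_nth _ ord0) => [|i].
  by rewrite size_mkseq size_takel// size_mkseq.
by rewrite size_mkseq => iv; rewrite nth_take// !nth_mkseq// (leq_trans iv).
Qed.

(** Two cylinders are nested or disjoint, so together with the empty set they form a pi-system. *)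
Lemma cylinder_meet u v :
  cylinder u `&` cylinder v = set0 :> set (boundary k) \/
  exists z, [/\ prefix u z, prefix v z &
    cylinder u `&` cylinder v = cylinder z :> set (boundary k)].
Proof.
wlog uv : u v / (size u <= size v)%N => [H|].
  case: (leqP (size u) (size v)) => [|/ltnW] /H//; rewrite setIC.
  by move=> [|[z [? ? ?]]]; [left|right; exists z].
case: (boolP (prefix u v)) => puv.
  right; exists v; split => //; first exact: prefix_refl.
  by apply/setIidr => x /cylinder_prefix; exact.
left; apply/seteqP; split => // x [ux vx]; case/negP: puv.
rewrite prefixE; apply/eqP/(@cylinder_disjoint _ _ x) => //.
  by rewrite size_takel.
by apply: cylinder_prefix vx _; exact: prefix_take.
Qed.

Lemma measure_level (R : realType) (m : {measure set (boundary k) -> \bar R})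
    n (B : set (boundary k)) : measurable B ->
  m B = (\sum_(w : n.-tuple 'I_k.+1) m (B `&` cylinder w))%E.
Proof.
move=> mB.
have BE : B = \bigcup_(w in [set: n.-tuple 'I_k.+1]) (B `&` cylinder w).
  apply/seteqP; split => [x Bx|x [w _ []//]].
  have sx : size (mkseq x n) == n by rewrite size_mkseq.
  by exists (Tuple sx) => //; split => //; rewrite /cylinder/= size_mkseq.
rewrite {1}BE measure_fin_bigcup; first last.
- by move=> w _; apply: measurableI => //; exact: measurable_cylinder.
- move=> u w _ _ [x [[_ ux] [_ wx]]]; apply: val_inj.
  by apply: cylinder_disjoint ux wx; rewrite !size_tuple.
- exact: finite_finset.
rewrite fsbig_finite/=; last exact: finite_finset.
rewrite (perm_big (enum {: n.-tuple 'I_k.+1})) ?big_enum//=.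
apply: uniq_perm => [||w]; [exact: finmap.fset_uniq|exact: enum_uniq|].
rewrite in_fset_set; last exact: finite_finset.
by rewrite mem_enum inE; exact/mem_set.
Qed.

End boundary_maps.

(** * The image measure and its density *)

Section bernoulli_measure.
Context (R : realType) (k : nat) (p : 'I_k.+1 -> R).
Hypotheses (p01 : forall i, 0 < p i < 1) (p_sum : \sum_(i < k.+1) p i = 1).
Context (mu : probability (boundary k) R).
Hypothesis hmu : is_bernoulli p mu.
Implicit Types (g h : word k -> word k) (u v w : word k) (x : boundary k).

Let p_gt0 i : 0 < p i. Proof. by case/andP: (p01 i). Qed.

Lemma bernoulli_cylinder w : mu (cylinder w) = (weight p w)%:E.
Proof.
have := hmu (fun i : 'I_(size w) => [set nth ord0 w i]).
have -> : [set x : boundary k | forall i : 'I_(size w), [set nth ord0 w i] (x i)] = cylinder w.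
  apply/seteqP; split => x /=.
    move=> xw; apply: (@eq_from_nth _ ord0); rewrite ?size_mkseq// => i iw.
    by rewrite nth_mkseq// (xw (Ordinal iw)).
  by move=> xw i; have := congr1 (nth ord0 ^~ i) xw; rewrite /= nth_mkseq.
move=> ->; congr (_%:E); rewrite /weight (big_nth ord0) big_mkord.
apply: eq_bigr => i _; rewrite (big_pred1 (nth ord0 w i)) // => a.
by apply/idP/eqP; rewrite inE.
Qed.

Section action.
Variables (g h : word k -> word k).
Hypotheses (hg : tree_aut g) (hh : tree_aut h) (gK : cancel g h).

(* As h inverts g, the distribution of hmap is the measure B |-> mu (g B). *)
Let hmap : {mfun boundary k >-> boundary k} :=
  mfun_Sub (mem_set (measurable_boundary_map hh)).

Lemma distribution_cylinder w :
  distribution mu hmap (cylinder w) = (weight p (g w))%:E.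
Proof.
rewrite /distribution/= /pushforward -{1}(gK w) preimage_boundary_map//.
exact: bernoulli_cylinder.
Qed.

(** Below [w] the map only replaces the prefix [w] by [g w], so the two measures are proportional on
    cylinders, hence everywhere by uniqueness on a pi-system. Cross-multiplied, both sides are
    measures and no quotient appears. *)
Lemma distribution_restriction_id w (B : set (boundary k)) :
  restriction g w = id -> measurable B ->
  ((weight p w)%:E * distribution mu hmap (B `&` cylinder w) =
   (weight p (g w))%:E * mu (B `&` cylinder w))%E.
Proof.
move=> gw mB.
have mw : measurable (cylinder w : set (boundary k)) := measurable_cylinder w.
pose cw := NngNum (weight_ge0 p_gt0 w).
pose cgw := NngNum (weight_ge0 p_gt0 (g w)).
pose C : set (set (boundary k)) := [set X | X = set0 \/ exists u, X = cylinder u].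
have Cm : C `<=` measurable.
  by move=> X [->//|[u ->]]; exact: measurable_cylinder.
apply: (g_sigma_algebra_measure_unique C Cm (fun=> setT) _ _
  (mscale cw (mrestr (distribution mu hmap) mw))
  (mscale cgw (mrestr mu mw))).
- by move=> _; right; exists [::]; apply/seteqP; split.
- by apply/seteqP; split => // x _; exists 0%N.
- move=> X Y [->|[u ->]]; first by rewrite set0I; left.
  move=> [->|[v ->]]; first by rewrite setI0; left.
  have [->|[z [_ _ ->]]] := cylinder_meet u v; first by left.
  by right; exists z.
- move=> X CX; rewrite /mscale/=; case: CX => [->|[u ->]].
    by rewrite !measure0.
  change ((weight p w)%:E * distribution mu hmap (cylinder u `&` cylinder w) =
    (weight p (g w))%:E * mu (cylinder u `&` cylinder w))%E.
  have [->|[z [_ /prefixP[y ->] ->]]] := cylinder_meet u w.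
    by rewrite !measure0 !mule0.
  rewrite distribution_cylinder bernoulli_cylinder restrictionE// gw.
  by rewrite !weight_cat -!EFinM; congr (_%:E); rewrite mulrCA.
- move=> _.
  change ((weight p w)%:E * distribution mu hmap (setT `&` cylinder w) < +oo)%E.
  by rewrite setTI distribution_cylinder ltry.
- apply: sub_sigma_algebra2 mB => X [u _ <-]; by right; exists u.
Qed.

Hypothesis g_subexp : subexp_bounded R g.

(** At level [n], the image measure of [B] vanishes below words with trivial restriction, by
    proportionality; the other words carry at most [active g n] times [gamma ^+ n], which is below
    any given [e] for a suitable [n]. *)
Lemma distribution_dominated (B : set (boundary k)) :
  measurable B -> mu B = 0%E -> distribution mu hmap B = 0%E.
Proof.
move=> mB B0; apply/eqP; rewrite eq_le measure_ge0 andbT.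
apply/lee_addgt0Pr => e e0; rewrite add0e.
have [gamma gamma01 pgamma] := letter_bound p01.
have [n /(_ n (leqnn n)) nP] := active_small 0 g_subexp gamma01 e0.
(* The form [[::] ++ w] is that of [sum_active_le] at the root. *)
apply: (@le_trans _ _ (\sum_(w : n.-tuple 'I_k.+1 |
    `[< restriction g ([::] ++ w) <> id >]) weight p (g w))%:E); last first.
  rewrite lee_fin; apply: le_trans nP.
  apply: (@sum_active_le _ _ g [::] n (fun w => weight p (g w))) => [|w].
    by rewrite exprn_ge0// ltW//; case/andP: gamma01.
  have := weight_le_exp p_gt0 (g w) pgamma.
  by rewrite size_tree_aut// size_tuple.
rewrite (measure_level _ n mB) -sumEFin [leRHS]big_mkcond; apply: lee_sum => w _.
have mw := measurable_cylinder (val w).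
case: asboolP => gw.
  rewrite -distribution_cylinder; apply: le_measure; rewrite ?inE//.
  exact: measurableI.
have {}gw : restriction g w = id by exact: contrapT.
have := distribution_restriction_id gw mB.
have -> : mu (B `&` cylinder w) = 0%E.
  by apply: (subset_measure0 _ mB) => //; exact: measurableI.
rewrite mule0 => /eqP; rewrite mule_eq0 eqe gt_eqF ?weight_gt0//= => /eqP E.
by apply: (@le_trans _ _ (distribution mu hmap (B `&` cylinder w))); rewrite ?E.
Qed.

Local Open Scope charge_scope.
Local Notation density :=
  ('d (charge_of_finite_measure (distribution mu hmap)) '/d mu).

Let density_dominated : charge_of_finite_measure (distribution mu hmap) `<< mu.
Proof. by apply/null_content_dominatesP => A; exact: distribution_dominated. Qed.

Lemma measurable_density : measurable_fun [set: boundary k] density.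
Proof. exact: (measurable_int mu (Radon_Nikodym_integrable density_dominated)). Qed.

Lemma density_ge_distribution (c : R) (B : set (boundary k)) : 0 <= c ->
  measurable B -> (forall x, B x -> c%:E <= density x)%E ->
  (c%:E * mu B <= distribution mu hmap B)%E.
Proof.
move=> c0 mB Bc.
have -> : distribution mu hmap B = charge_of_finite_measure (distribution mu hmap) B by [].
rewrite (Radon_Nikodym_integral density_dominated mB) -integral_cst//.
apply: ge0_le_integral => //.
exact: (measurable_funS measurableT (@subsetT _ B) measurable_density).
Qed.

(** The first [n] letters decide membership in [W], and [j] further letters carry the affinity.
    Below a fixed [w] the cylinder bounds add up to at most [M * t * weight p w], and the weights
    sum to 1. *)
Lemma density_ge_mass (M t : R) n j (W : set (word k)) (B : set (boundary k)) :
  0 < M -> 0 <= t -> measurable B ->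
  (forall x, B x -> W (mkseq x n) /\ ((M ^- 2)%:E <= density x)%E) ->
  (forall w, W w -> size w = n -> g w = w /\ affinity p g w j <= t) ->
  (mu B <= (M * t)%:E)%E.
Proof.
move=> M0 t0 mB BW gW.
have cyl_bound u : (mu (B `&` cylinder u) <=
    (M * Num.sqrt (weight p u * weight p (g u)))%:E)%E.
  have mu_ : measurable (cylinder u : set (boundary k)) := measurable_cylinder u.
  have mBu : measurable (B `&` cylinder u) by exact: measurableI.
  have h1 : (mu (B `&` cylinder u) <= (weight p u)%:E)%E.
    by rewrite -bernoulli_cylinder; apply: le_measure; rewrite ?inE.
  have h2 : ((M ^- 2)%:E * mu (B `&` cylinder u) <= (weight p (g u))%:E)%E.
    apply: le_trans (density_ge_distribution _ mBu _) _.
    - by rewrite invr_ge0 sqr_ge0.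
    - by move=> x [/BW[]].
    - by rewrite -distribution_cylinder; apply: le_measure; rewrite ?inE.
  move: h1 h2; rewrite -(fineK (fin_num_measure mu _ mBu)) -EFinM !lee_fin.
  set b := fine _ => h1 h2.
  have b0 : 0 <= b by rewrite fine_ge0.
  have Mb : b <= M ^+ 2 * weight p (g u).
    by rewrite mulrC -ler_pdivrMr ?exprn_gt0// mulrC.
  (* After squaring, the claim is the product of the bounds [weight p u] and
     [M ^+ 2 * weight p (g u)] on [b]. *)
  rewrite -(ler_pXn2r (n := 2))// ?nnegrE ?mulr_ge0 ?sqrtr_ge0 ?(ltW M0)//.
  rewrite exprMn sqr_sqrtr ?mulr_ge0 ?weight_ge0// mulrCA expr2.
  by apply: ler_pM.
rewrite (measure_level _ (n + j) mB).
rewrite (sum_cat_tuple _ _ (fun u => mu (B `&` cylinder u))).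
apply: (@le_trans _ _ (\sum_(w : n.-tuple 'I_k.+1) (M * t * weight p w))%:E); last first.
  by rewrite -mulr_sumr sum_weight ?mulr1.
rewrite -sumEFin; apply: lee_sum => w _.
have [Ww|nWw] := pselect (W w); last first.
  rewrite big1 ?lee_fin ?mulr_ge0 ?weight_ge0 ?(ltW M0)// => y _.
  have -> : B `&` cylinder (w ++ y) = set0; last exact: measure0.
  apply/seteqP; split => // x [/BW[Wx _] wyx]; apply: nWw.
  have := cylinder_prefix wyx (prefix_prefix w y).
  by rewrite /cylinder/= size_tuple => <-.
have [gw gt] := gW _ Ww (size_tuple w).
apply: (@le_trans _ _ (\sum_(y : j.-tuple 'I_k.+1)
    M * weight p w * Num.sqrt (weight p y * weight p (restriction g w y)))%:E).
  rewrite -sumEFin; apply: lee_sum => y _; apply: le_trans (cyl_bound _) _.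
  rewrite lee_fin restrictionE// gw !weight_cat mulrACA sqrtrM ?mulr_ge0 ?weight_ge0//.
  by rewrite -expr2 sqrtr_sqr ger0_norm ?weight_ge0// mulrA.
rewrite -mulr_sumr lee_fin -[leRHS]mulrA [t * _]mulrC mulrA.
by rewrite ler_wpM2l ?mulr_ge0 ?weight_ge0 ?(ltW M0).
Qed.

End action.
End bernoulli_measure.

(** * Approximation by finite-level sets *)

Section finite_levels.
Context (k : nat).
Implicit Types (W : set (word k)) (x : boundary k).

Definition level_set n W : set (boundary k) := [set x | W (mkseq x n)].

Lemma take_mkseq x m n : (n <= m)%N -> take n (mkseq x m) = mkseq x n.
Proof.
by move=> nm; rewrite /mkseq -map_take take_iota (minn_idPl nm).
Qed.

Lemma measurable_level_set n W : measurable (level_set n W).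
Proof.
have -> : level_set n W =
    \bigcup_(w in [set w : n.-tuple 'I_k.+1 | W w]) cylinder w.
  apply/seteqP; split => [x Wx|x [w Ww]]; last first.
    by rewrite /cylinder/level_set/= size_tuple => ->.
  have sx : size (mkseq x n) == n by rewrite size_mkseq.
  by exists (Tuple sx) => //; rewrite /cylinder/= size_mkseq.
apply: fin_bigcup_measurable => [|w _]; first exact: finite_finset.
exact: measurable_cylinder.
Qed.

Lemma level_set_lift n m W : (n <= m)%N ->
  level_set n W = level_set m [set w | W (take n w)].
Proof. by move=> nm; apply/seteqP; split => x; rewrite /level_set/= take_mkseq. Qed.

Lemma level_setU n m W V : exists N U,
  level_set n W `|` level_set m V = level_set N U.
Proof.
rewrite (level_set_lift _ (leq_maxl n m)) (level_set_lift _ (leq_maxr n m)).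
exists (maxn n m), ([set w | W (take n w)] `|` [set w | V (take m w)]).
by apply/seteqP; split.
Qed.

Context (R : realType) (mu : probability (boundary k) R).
Local Open Scope ereal_scope.

Definition level_approx (A : set (boundary k)) : Prop :=
  forall e : R, (0 < e)%R -> exists n W,
    mu ((A `\` level_set n W) `|` (level_set n W `\` A)) <= e%:E.

Let le_mu_cover (X Y Z : set (boundary k)) : measurable X -> measurable Y ->
  measurable Z -> X `<=` Y `|` Z -> mu X <= mu Y + mu Z.
Proof.
move=> mX mY mZ XYZ; apply: le_trans (measureU2 mu mY mZ).
by apply: le_measure; rewrite ?inE//; exact: measurableU.
Qed.

Let measurable_symdiff (A C : set (boundary k)) : measurable A -> measurable C ->
  measurable ((A `\` C) `|` (C `\` A)).
Proof. by move=> mA mC; apply: measurableU; exact: measurableD. Qed.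

Let level_approxU (A B : set (boundary k)) : measurable A -> measurable B ->
  level_approx A -> level_approx B -> level_approx (A `|` B).
Proof.
move=> mA mB hA hB e e0; have e20 : (0 < e / 2)%R by rewrite divr_gt0.
have [n [W nW]] := hA _ e20; have [m [V mV]] := hB _ e20.
have [N [U NU]] := level_setU n m W V; exists N, U; rewrite -NU.
have mW := measurable_level_set n W; have mV' := measurable_level_set m V.
rewrite [e in leRHS]splitr EFinD; apply: le_trans (leeD nW mV).
apply: le_mu_cover; try by apply: measurable_symdiff => //; exact: measurableU.
move=> x [[[Ax|Bx] /not_orP[nWx nVx]]|[[Wx|Vx] /not_orP[nAx nBx]]].
- by left; left.
- by right; left.
- by left; right.
- by right; right.
Qed.

Let level_approx0 : level_approx set0.
Proof.
move=> e e0; exists 0%N, set0; have -> : level_set 0 set0 = set0 by [].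
by rewrite setDv setU0 measure0 lee_fin ltW.
Qed.

(** The approximable measurable sets form a sigma-algebra containing the cylinders: complements
    leave the symmetric difference unchanged, and continuity from below replaces a countable union
    by a finite one. *)
Lemma measurable_level_approx (A : set (boundary k)) : measurable A -> level_approx A.
Proof.
suff: @measurable _ (boundary k) `<=` [set A | measurable A /\ level_approx A].
  by move=> H /H[].
apply: smallest_sub; last first.
  move=> _ [w _ <-]; split; first exact: measurable_cylinder.
  move=> e e0; exists (size w), [set w].
  by rewrite setDv setU0 measure0 lee_fin ltW.
split.
- by split; [exact: measurable0|exact: level_approx0].
- move=> B [mB hB]; rewrite setTD; split; first exact: measurableC.
  move=> e /hB[n [W nW]]; exists n, (~` W).
  rewrite (_ : level_set n (~` W) = ~` level_set n W)//.
  by rewrite !setDE !setCK setUC setIC [X in _ `|` X]setIC.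
- move=> F0 hF; pose F : (set (boundary k))^nat := F0.
  have mF i : measurable (F i) by case: (hF i).
  have mU : measurable (\bigcup_i F i) by exact: bigcupT_measurable.
  split => // e e0; have e20 : (0 < e / 2)%R by rewrite divr_gt0.
  have mP N : measurable (\big[setU/set0]_(i < N) F i) by exact: bigsetU_measurable.
  have hP N : level_approx (\big[setU/set0]_(i < N) F i).
    elim: N => [|N IH]; first by rewrite big_ord0; exact: level_approx0.
    by rewrite big_ord_recr/=; exact: (level_approxU (mP N) (mF N) IH (hF N).2).
  pose P N := \big[setU/set0]_(i < N.+1) F i.
  have PU : \bigcup_N P N = \bigcup_i F i by rewrite bigcup_bigsetU_bigcup.
  have : mu \o P @ \oo --> mu (\bigcup_N P N).
    apply: nondecreasing_cvg_mu => [N||]; [exact: mP|by rewrite PU|].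
    by apply/nondecreasing_seqP => N; rewrite /P [leRHS]big_ord_recr/= subsetEset; left.
  rewrite PU -(fineK (fin_num_measure mu _ mU)) => /fine_cvgP[_].
  move=> /cvgrPdist_lt/(_ _ e20)[N _ /(_ N (leqnn N))] /= AN.
  have [n [W nW]] := hP N.+1 _ e20; exists n, W.
  have mW := measurable_level_set n W.
  have UP : mu (\bigcup_i F i `\` P N) <= (e / 2)%:E.
    have mPN : measurable (P N) := mP N.+1.
    rewrite measureD//; last by rewrite ltey_eq fin_num_measure.
    rewrite (setIidr (_ : P N `<=` _)); last by rewrite -PU; exact: bigcup_sup.
    rewrite -(fineK (fin_num_measure mu _ mU)) -(fineK (fin_num_measure mu _ mPN)).
    by rewrite -EFinB lee_fin (le_trans (ler_norm _))// ltW.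
  rewrite [e in leRHS]splitr EFinD; apply: le_trans (leeD nW UP).
  apply: le_mu_cover; [exact: measurable_symdiff|
    exact: (measurable_symdiff (mP _) mW)|exact: (measurableD mU (mP _))|].
  move=> x [[Fx nWx]|[Wx nFx]].
    have [PNx|nPNx] := pselect (P N x); [by left; left|by right].
  by left; right; split => // PNx; apply: nFx; rewrite -PU; exists N.
Qed.

End finite_levels.

(** * Quasi-invariance and contraction *)

Lemma sqrte_geV (R : realType) (M : R) (y : \bar R) : 0 < M ->
  ((M^-1)%:E <= sqrte y)%E = ((M ^- 2)%:E <= y)%E.
Proof.
(* The extended real [y] may have any sign. For negative values and [-oo] the root is 0, so both
   sides fail because [M^-1 > 0]. *)
move=> M0; case: y => [r| |]; rewrite ?leey//= ?lee_fin; last first.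
  by rewrite leNgt invr_gt0 M0 leNgt ltNyr.
have [r0|r0] := leP 0 r; last first.
  by rewrite ltr0_sqrtr// leNgt invr_gt0 M0/=; apply/esym/negbTE;
    rewrite -ltNge (lt_trans r0)// invr_gt0 exprn_gt0.
rewrite -[in RHS](sqr_sqrtr r0) -exprVn ler_pXn2r// nnegrE ?sqrtr_ge0//.
by rewrite invr_ge0 ltW.
Qed.

Theorem proposition4 (R : realType) (k : nat) (G : set (word k -> word k))
    (p : 'I_k.+1 -> R) (mu : probability (boundary k) R)
    (hG : aut_subgroup G)
    (hsub : forall g, G g -> subexp_bounded R g)
    (hwb : weakly_branch G)
    (hp01 : forall i, 0 < p i < 1)
    (hpinj : injective p)
    (hpsum : \sum_(i < k.+1) p i = 1)
    (hmu : is_bernoulli p mu) :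
  measure_contracting mu [set boundary_map g | g in G].
Proof.
split.
  move=> _ [g Gg <-]; have [_ _ _ /(_ _ Gg)[h Gh [gK hK]]] := hG.
  have hg := aut_subgroup_aut hG Gg; have hh := aut_subgroup_aut hG Gh.
  (* Images under [g] are preimages under its inverse [h], so quasi-invariance follows from
     [distribution_dominated] applied to [g] and to [h]. *)
  have imE B : boundary_map g @` B = boundary_map h @^-1` B.
    apply/seteqP; split => [_ [x Bx <-]|x /= Bx].
      by rewrite /preimage/= (boundary_mapK hg hh gK).
    by exists (boundary_map h x) => //; rewrite (boundary_mapK hh hg hK).
  split; first exact: measurable_boundary_map.
  move=> B mB; rewrite imE; split => [gB0|B0].
    have mgB : measurable (boundary_map h @^-1` B).
      by rewrite -[X in measurable X]setTI; exact: measurable_boundary_map.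
    have := distribution_dominated hp01 hmu hh hg hK (hsub _ Gh) mgB gB0.
    rewrite /distribution/= /pushforward -comp_preimage.
    suff -> : boundary_map h \o boundary_map g = id by [].
    by apply/funext => x /=; rewrite (boundary_mapK hg hh gK).
  exact: (distribution_dominated hp01 hmu hg hh gK (hsub _ Gg) mB B0).
move=> A mA M e M0 e0; have p_gt0 i : 0 < p i by case/andP: (hp01 i).
have e20 : 0 < e / 2 by rewrite divr_gt0.
(* The error budget is [e / 4] for approximating [A] and [e / 2] for the points of large density, in
   total less than [e]. *)
have e40 : 0 < e / 4 by rewrite divr_gt0.
have [n [W AW]] := measurable_level_approx mu mA e40.
(* This affinity bound, multiplied by the factor [M] of [density_ge_mass], gives the allotted
   [e / 2]. *)
have t0 : 0 < e / 2 / M by rewrite divr_gt0.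
have /choice[F FP] : forall w, exists f, rist G w f /\
    exists i, affinity p f w i <= e / 2 / M.
  move=> w; have [f [i [fw fi]]] :=
    rist_affinity_small hp01 hpsum hpinj hG hwb hsub t0 w.
  by exists f; split => //; exists i.
have /choice[I IP] : forall w, exists i, affinity p (F w) w i <= e / 2 / M.
  by move=> w; have [_] := FP w.
pose j := \max_(w : n.-tuple 'I_k.+1) I w.
pose s := [seq val w | w <- enum {: n.-tuple 'I_k.+1} & `[< W (val w) >]].
have sP w : (w \in s) = (size w == n) && `[< W w >].
  apply/mapP/andP => [[x + ->]|[sw Ww]].
    by rewrite mem_filter size_tuple => /andP[? _].
  by exists (Tuple sw) => //; rewrite mem_filter mem_enum andbT.
have szs w : w \in s -> size w = n by rewrite sP => /andP[/eqP].
have [g Gg gE] := rist_glue hG szs (fun w _ => (FP w).1).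
have [_ _ _ /(_ _ Gg)[h Gh [gK hK]]] := hG.
have hg := aut_subgroup_aut hG Gg; have hh := aut_subgroup_aut hG Gh.
have gF w : W w -> size w = n -> forall u, g (w ++ u) = F w (w ++ u).
  move=> Ww sw u; rewrite gE -sw take_size_cat// sP sw eqxx/=.
  by case: asboolP.
have gW w : W w -> size w = n -> g w = w /\ affinity p g w j <= e / 2 / M.
  move=> Ww sw; split.
    by rewrite -[w in LHS]cats0 gF// cats0 (rist_fix hG (FP w).1).
  rewrite (@eq_affinity _ _ p g (F w)); last by move=> u; rewrite /restriction gF.
  apply: le_trans (IP w); apply: affinity_monotone => //.
    exact: (aut_subgroup_aut hG (FP w).1.1).
  have sw' : size w == n by rewrite sw.
  exact: (leq_bigmax (F := fun x : n.-tuple 'I_k.+1 => I x) (Tuple sw')).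
pose gm : {mfun boundary k >-> boundary k} :=
  mfun_Sub (mem_set (measurable_boundary_map hg)).
pose hm : {mfun boundary k >-> boundary k} :=
  mfun_Sub (mem_set (measurable_boundary_map hh)).
exists gm, hm.
pose C : set (boundary k) := level_set n W.
have mC : measurable C := measurable_level_set n W.
have mAC : measurable (A `\` C) by exact: measurableD.
have mCA : measurable (C `\` A) by exact: measurableD.
have AC_small : (mu (A `\` C) <= (e / 4)%:E)%E.
  by apply: le_trans AW; apply: le_measure; rewrite ?inE//; exact: measurableU.
have CA_small : (mu (C `\` A) <= (e / 4)%:E)%E.
  by apply: le_trans AW; apply: le_measure; rewrite ?inE//; exact: measurableU.
have supp_sub : [set x | gm x <> x] `<=` C.
  move=> x /= gx; apply: contrapT => nCx; apply: gx; apply: boundary_eqP => m.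
  rewrite mkseq_boundary_map// gE; case: ifP => //; rewrite sP => /andP[/eqP sz /asboolP].
  (* A prefix shorter than [n] cannot belong to [s], whose words all have length [n]. *)
  have nm : (n <= m)%N by rewrite -sz size_take size_mkseq; case: ltnP => // /ltnW.
  by rewrite take_mkseq// => /nCx.
(* A point is moved exactly when one of its finite prefixes is, so the support is a countable union
   of level sets. *)
have msupp : measurable [set x | gm x <> x].
  rewrite (_ : [set x | _] = \bigcup_m level_set m [set w | g w <> w]).
    by apply: bigcupT_measurable => m; exact: measurable_level_set.
  apply/seteqP; split => [x /= gx|x [m _ /=] + gx].
    apply: contrapT => nx; apply: gx; apply: boundary_eqP => m.
    rewrite mkseq_boundary_map//; apply: contrapT => gm'; apply: nx.
    by exists m.
  by apply; rewrite -mkseq_boundary_map// -/(gm x) gx.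
split.
- by exists g.
- exact: boundary_mapK.
- exact: boundary_mapK.
- apply: (@le_lt_trans _ _ (e / 4)%:E); last by rewrite lte_fin; lra.
  apply: le_trans CA_small; apply: le_measure; rewrite ?inE//.
    exact: measurableD.
  exact: setSD.
pose f := Radon_Nikodym (charge_of_finite_measure (distribution mu hm)) mu.
have mf : measurable_fun [set: boundary k] f.
  exact: (measurable_density hp01 hmu hg hh gK (hsub _ Gg)).
rewrite (_ : [set x | _] = A `&` [set x | f x < (M ^- 2)%:E]%E); last first.
  by apply/seteqP; split => x [Ax] /=; rewrite !ltNge sqrte_geV.
(* The bad set is taken in [C], whose points have their first [n] letters in [W], as
   [density_ge_mass] requires. *)
pose B := C `&` [set x | (M ^- 2)%:E <= f x]%E.
have mB : measurable B.
  by apply: emeasurable_fun_c_infty => //; exact: measurable_funTS.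
have mgood : measurable (A `&` [set x | f x < (M ^- 2)%:E]%E).
  by apply: emeasurable_fun_infty_o => //; exact: measurable_funTS.
have B_small : (mu B <= (e / 2)%:E)%E.
  have -> : e / 2 = M * (e / 2 / M) by rewrite [RHS]mulrC divfK// gt_eqF.
  exact: (density_ge_mass hp01 hpsum hmu hg gK (hsub _ Gg) (n := n) (W := W)
    M0 (ltW t0) mB (fun x Bx => Bx) gW).
set good := A `&` _ in mgood *.
have A_cover : A `<=` (good `|` (A `\` C)) `|` B.
  move=> x Ax; have [Cx|nCx] := pselect (C x); last by left; right.
  by case: (ltP (f x) (M ^- 2)%:E) => fx; [left; left|right].
have A_le : (mu A <= mu good + (e / 4)%:E + (e / 2)%:E)%E.
  apply: (@le_trans _ _ (mu ((good `|` (A `\` C)) `|` B))).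
    by apply: le_measure; rewrite ?inE//; do 2?[apply: measurableU => //].
  apply: le_trans (measureU2 mu _ mB) _; first exact: measurableU.
  by apply: leeD B_small; apply: le_trans (measureU2 mu mgood mAC) _; exact: leeD2l.
move: A_le; rewrite -(fineK (fin_num_measure mu _ mA)).
rewrite -(fineK (fin_num_measure mu _ mgood)) -EFinB -!EFinD lee_fin lte_fin; lra.
Qed.
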